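(* Let $\{(X_t,c_t):t\in T\}$ be a family of fuzzy closure spaces (with each $X_t$ non-empty). Then their product $\big(\prod_{t\in T}X_t,\otimes c_t\big)$ is ČF$T_1$ if and only if each factor space $(X_t,c_t)$ is ČF$T_1$.
   Context: $I=[0,1]$; a fuzzy (sub)set of a non-empty set $X$ is a map $f:X\to I$, and $I^X$ is the set of all of them, ordered pointwise, with $\vee,\wedge$ pointwise supremum/infimum. $\underline 0$ is the constant $0$ fuzzy set; the complement is $\mathfrak{Co}(f)(x)=1-f(x)$. For $x\in X$ and $0<\lambda\le1$, the fuzzy point $x_\lambda$ has value $\lambda$ at $x$ and $0$ elsewhere; $x_\lambda\in f$ means $x_\lambda\le f$, i.e. $\lambda\le f(x)$. Fuzzy points $x_\lambda,y_\gamma$ are distinct if $x\ne y$. A fuzzy closure space is a pair $(X,c)$ with $X$ a non-empty set and $c:I^X\to I^X$ satisfying $c(\underline 0)=\underline 0$, $f\le c(f)$, and $c(f\vee g)=c(f)\vee c(g)$ for all $f,g\in I^X$ (idempotency is not required). For $\theta:X\to Y$ and $f\in I^X$, $\theta(f)(y)=\sup\{f(x):\theta(x)=y\}$ if $\theta^{-1}(y)\ne\emptyset$, and $0$ otherwise. Product: let $X=\prod_{t\in T}X_t$ with projections $P_t:X\to X_t$. The operator $\otimes c_t:I^X\to I^X$ is defined by: for a fuzzy point $x_\lambda$ and $f\in I^X$, $x_\lambda\le\otimes c_t(f)$ iff for every finite decomposition $f=f_1\vee\cdots\vee f_n$ with $f_i\in I^X$ there is an $i$ such that $P_t(x_\lambda)\le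 c_t(P_t(f_i))$ for all $t\in T$. $(X,c)$ is ČF$T_1$ if for every two distinct fuzzy points $x_\lambda,y_\gamma$ of $X$, both $x_\lambda\in\mathfrak{Co}(c(y_\gamma))$ and $y_\gamma\in\mathfrak{Co}(c(x_\lambda))$. *)

(* Defs.v *)
From mathcomp Require Import all_boot all_order all_algebra.
From mathcomp Require Import boolp classical_sets reals interval_inference.

Set Implicit Arguments.
Unset Strict Implicit.
Unset Printing Implicit Defensive.

Import Order.TTheory GRing.Theory Num.Theory.

Local Open Scope classical_set_scope.
Local Open Scope ring_scope.

Definition i01_0 (R : realType) : {i01 R} := 0%:i01.
Arguments i01_0 {R}.

Section I01Sup.
Variable R : realType.
Implicit Types (A : set {i01 R}) (x m : {i01 R}).

Lemma i01_ge0 x : i01_0 <= x.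
Proof. by rewrite -num_le /= ge0. Qed.

Lemma num_has_ubound A : has_ubound [set a%:num | a in A].
Proof. by exists 1 => _ [a _ <-]. Qed.

Lemma i01_sup_ge0 A : 0 <= sup [set a%:num | a in A].
Proof.
have [->|/set0P[a Aa]] := eqVneq A set0; first by rewrite image_set0 sup0.
apply: (@le_trans _ _ a%:num) => //.
by apply: (ub_le_sup (@num_has_ubound A)); exists a.
Qed.

Lemma i01_sup_le1 A : sup [set a%:num | a in A] <= 1.
Proof.
have [->|/set0P[a Aa]] := eqVneq A set0; first by rewrite image_set0 sup0.
by apply: ge_sup; [exists a%:num, a | move=> _ [b _ <-]].
Qed.

(* The supremum in the complete lattice [0,1]; it is 0 on the empty set. *)
Definition i01_sup A : {i01 R} := Itv01 (i01_sup_ge0 A) (i01_sup_le1 A).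

Lemma i01_sup_ub A x : A x -> x <= i01_sup A.
Proof.
move=> Ax; rewrite -num_le /=.
by apply: (ub_le_sup (@num_has_ubound A)); exists x.
Qed.

Lemma i01_sup_le A m : (forall x, A x -> x <= m) -> i01_sup A <= m.
Proof.
move=> Am; rewrite -num_le /=.
have [->|/set0P[a Aa]] := eqVneq A set0; first by rewrite image_set0 sup0.
by apply: ge_sup; [exists a%:num, a | move=> _ [b /Am bm <-]; rewrite num_le].
Qed.

End I01Sup.

Definition fuzzy (R : realType) (X : Type) := X -> {i01 R}.

Section Fuzzy.
Variables (R : realType) (X Y : Type).
Implicit Types f g : fuzzy R X.

Definition fuzzy_le f g : Prop := forall x, f x <= g x.

Definition fuzzy0 : fuzzy R X := fun=> i01_0.

Definition fuzzy_max f g : fuzzy R X := fun x => Num.max (f x) (g x).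

Definition fuzzy_bigmax n (F : 'I_n -> fuzzy R X) : fuzzy R X :=
  fun x => \big[Num.max/i01_0]_(i < n) F i x.

Definition fuzzy_compl f : fuzzy R X := fun x => (1 - (f x)%:num)%:i01.

(* A fuzzy point when 0 < l. *)
Definition fuzzy_point (x : X) (l : {i01 R}) : fuzzy R X :=
  fun z => if `[< z = x >] then l else i01_0.

Definition fuzzy_image (h : X -> Y) f : fuzzy R Y :=
  fun y => i01_sup [set f x | x in [set x | h x = y]].

Lemma fuzzy_point_le x l f : fuzzy_le (fuzzy_point x l) f <-> l <= f x.
Proof.
split=> [/(_ x)|lf z]; rewrite /fuzzy_point; first by rewrite asboolT.
by case: asboolP => [->//|_]; exact: i01_ge0.
Qed.

Record is_fuzzy_closure_space (c : fuzzy R X -> fuzzy R X) : Prop := {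
  fcs_nonempty : inhabited X;
  fcs_zero : c fuzzy0 = fuzzy0;
  fcs_ext : forall f, fuzzy_le f (c f);
  fcs_max : forall f g, c (fuzzy_max f g) = fuzzy_max (c f) (c g) }.

Definition CFT1 (c : fuzzy R X -> fuzzy R X) : Prop :=
  forall (x y : X) (l m : {i01 R}), i01_0 < l -> i01_0 < m -> x <> y ->
    fuzzy_le (fuzzy_point x l) (fuzzy_compl (c (fuzzy_point y m))) /\
    fuzzy_le (fuzzy_point y m) (fuzzy_compl (c (fuzzy_point x l))).

End Fuzzy.

Lemma fuzzy_image_point (R : realType) (X Y : Type) (h : X -> Y) x l :
  fuzzy_image h (fuzzy_point x l) = fuzzy_point (h x) l :> fuzzy R Y.
Proof.
apply/funext => y; apply/le_anti/andP; split.
  apply: i01_sup_le => _ [z /= hz <-]; rewrite /fuzzy_point.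
  case: asboolP => [zx|_]; last exact: i01_ge0.
  by rewrite asboolT // -zx hz.
rewrite {1}/fuzzy_point; case: asboolP => [yx|_]; last exact: i01_ge0.
by apply: i01_sup_ub; exists x => //=; rewrite /fuzzy_point asboolT.
Qed.

Section Product.
Variables (R : realType) (T : Type) (X : T -> Type).
Variable c : forall t, fuzzy R (X t) -> fuzzy R (X t).
Implicit Types (f : fuzzy R (forall t, X t)) (x : forall t, X t).

Definition proj t x : X t := x t.

(* Decompositions are indexed by 'I_n.+1: at least one piece. *)
Definition prod_adherent x (l : {i01 R}) f : Prop :=
  forall n (F : 'I_n.+1 -> fuzzy R (forall t, X t)), f = fuzzy_bigmax F ->
    exists i, forall t,
      fuzzy_le (fuzzy_image (@proj t) (fuzzy_point x l))
               (c (fuzzy_image (@proj t) (F i))).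

(* The operator determined by the fuzzy points it contains, see
   [prod_closureP]. *)
Definition prod_closure f : fuzzy R (forall t, X t) :=
  fun x => i01_sup [set l | i01_0 < l /\ prod_adherent x l f].

Lemma prod_closureP f x (l : {i01 R}) : i01_0 < l ->
  fuzzy_le (fuzzy_point x l) (prod_closure f) <-> prod_adherent x l f.
Proof.
move=> l0; rewrite fuzzy_point_le; split; last by move=> ?; exact: i01_sup_ub.
move=> lS n F fF; apply: contrapT => /forallNP Fl.
have {}Fl i : exists t, c (fuzzy_image (@proj t) (F i)) (x t) < l.
  apply: contrapT => /forallNP Fil; apply: (Fl i) => t.
  by rewrite fuzzy_image_point fuzzy_point_le leNgt; apply/negP/Fil.
have [t Ft] := choice Fl.
pose m := \big[Num.max/i01_0]_i c (fuzzy_image (@proj (t i)) (F i)) (x (t i)).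
have ml : m < l by apply/bigmax_ltP; split.
suff : prod_closure f x <= m by rewrite leNgt (lt_le_trans ml lS).
apply: i01_sup_le => k [_ /(_ n F fF)[i /(_ (t i))]].
rewrite fuzzy_image_point fuzzy_point_le => /le_trans; apply.
exact: (le_bigmax _ (fun i => c (fuzzy_image (@proj (t i)) (F i)) (x (t i)))).
Qed.

End Product.

(* Main.v *)
(* Evaluating at [l = 1], CFT1 says that the closure of every fuzzy point
   [y_m] vanishes at all [x <> y]. In any finite decomposition of [y_m] one of
   the pieces is [y_m] itself, so the value of the product closure of [y_m] at
   [x] is the infimum over [t] of the values of [c t (y t)_m] at [x t]. It is 0
   as soon as one of these is; conversely, for [x] and [y] that differ only at
   [t] it is positive if [c t (y t)_m] is positive at [x t], because the other
   coordinates contribute at least [m]. *)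
Require Import Defs.
From mathcomp Require Import all_boot all_order all_algebra.
From mathcomp Require Import boolp classical_sets reals interval_inference.

Set Implicit Arguments.
Unset Strict Implicit.
Unset Printing Implicit Defensive.

Import Order.TTheory GRing.Theory Num.Theory.

Local Open Scope ring_scope.

Lemma CFT1P (R : realType) (X : Type) (c : fuzzy R X -> fuzzy R X) :
  CFT1 c <-> forall (x y : X) (m : {i01 R}), i01_0 < m -> x <> y ->
    c (fuzzy_point y m) x = i01_0.
Proof.
split=> [cT1 x y m m0 xy|c0 x y l m l0 m0 xy].
  have l0 : (i01_0 : {i01 R}) < 1%:i01 by rewrite -num_lt.
  have [/fuzzy_point_le + _] := cT1 x y 1%:i01 m l0 m0 xy.
  rewrite -num_le /= lerBrDr gerDl => c_le0.
  by apply/le_anti; rewrite i01_ge0 -num_le /= c_le0.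
rewrite !fuzzy_point_le /fuzzy_compl !c0 //; last exact: nesym.
by split; rewrite -num_le /= subr0 le1.
Qed.

(** All pieces lie below the point, hence vanish off [y]; a maximum of finitely many values is
    attained, so one piece reaches [m] at [y]. *)
Lemma fuzzy_point_bigmax (R : realType) (X : Type) (y : X) (m : {i01 R}) n
    (F : 'I_n.+1 -> fuzzy R X) :
  fuzzy_point y m = fuzzy_bigmax F -> exists i, F i = fuzzy_point y m.
Proof.
move=> yF.
have F_le i z : F i z <= fuzzy_point y m z.
  by rewrite yF; exact: (le_bigmax _ (fun i => F i z)).
have [i m_le] : exists i, m <= F i y.
  apply: contrapT => /forallNP F_lt.
  (* The strict bound on the maximum also needs its default value [i01_0] to be below [m]; for
     [m = 0] any piece works. *)
  have [m0|m0] := leP m i01_0.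
    by apply: (F_lt ord0); exact: le_trans m0 (i01_ge0 _).
  have : fuzzy_bigmax F y < m.
    by apply/bigmax_ltP; split=> // i _; rewrite ltNge; apply/negP/F_lt.
  by rewrite -yF /fuzzy_point asboolT // ltxx.
exists i; apply/funext => z; apply/le_anti; rewrite F_le /=.
by rewrite /fuzzy_point; case: asboolP => [->//|_]; exact: i01_ge0.
Qed.

(** Forward, the one-piece decomposition suffices; backward, the piece equal to the point serves all
    [t] at once. *)
Lemma prod_adherent_point (R : realType) (T : Type) (X : T -> Type)
    (c : forall t, fuzzy R (X t) -> fuzzy R (X t)) (x y : forall t, X t)
    (l m : {i01 R}) :
  prod_adherent c x l (fuzzy_point y m) <->
  forall t, l <= c t (fuzzy_point (y t) m) (x t).
Proof.
split=> [adh t|l_le n F yF].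
  have yF : fuzzy_point y m = fuzzy_bigmax (fun _ : 'I_1 => fuzzy_point y m).
    apply/funext => z; rewrite /fuzzy_bigmax big_ord_recl big_ord0.
    by apply/esym/max_idPl; exact: i01_ge0.
  have [_ /(_ t)] := adh _ _ yF.
  by rewrite 2!fuzzy_image_point => /fuzzy_point_le.
have [i Fi] := fuzzy_point_bigmax yF.
by exists i => t; rewrite Fi 2!fuzzy_image_point; apply/fuzzy_point_le.
Qed.

Theorem theorem5p8 (R : realType) (T : Type) (X : T -> Type)
    (c : forall t : T, fuzzy R (X t) -> fuzzy R (X t))
    (cfcs : forall t : T, is_fuzzy_closure_space (c t)) :
  CFT1 (prod_closure c) <-> forall t : T, CFT1 (c t).
Proof.
split=> [/CFT1P prodT1 t|cT1]; apply/CFT1P.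
- move=> a b m m0 ab; apply: contrapT => c_neq0.
  have c_gt0 : i01_0 < c t (fuzzy_point b m) a.
    by rewrite lt_neqAle i01_ge0 andbT eq_sym; apply/eqP.
  (* A base point, chosen from the nonempty factors, fills in the coordinates other than [t]. *)
  have z s : X s.
    apply: projT1 (cid (P := fun _ : X s => True) _).
    by case: (cfcs s) => -[w]; exists w.
  pose upd (w : X t) : forall s, X s := @dfwith {classic T} X z t w.
  have updt w : upd w t = w by exact: dfwith_in.
  have updN w s : t <> s -> upd w s = z s.
    by move=> ts; apply: dfwith_out; apply/eqP.
  have upd_neq : upd a <> upd b.
    by move=> /(congr1 (fun f => f t)); rewrite !updt.
  (* The first term is the bound at [t], the second the bound elsewhere, where both points have
     coordinate [z s] and [c s] is extensive. *)
  pose l := Num.min (c t (fuzzy_point b m) a) m.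
  have l0 : i01_0 < l by rewrite lt_min c_gt0.
  have : prod_adherent c (upd a) l (fuzzy_point (upd b) m).
    apply/prod_adherent_point => s; have [<-|ts] := pselect (t = s).
      by rewrite !updt ge_min lexx.
    rewrite !updN // ge_min; apply/orP; right.
    exact/fuzzy_point_le/(fcs_ext (cfcs s)).
  move=> /(prod_closureP _ _ _ l0)/fuzzy_point_le.
  by rewrite (prodT1 _ _ _ m0 upd_neq) leNgt l0.
- move=> x y m m0 xy.
  have [t xyt] : exists t, x t <> y t.
    apply: contrapT => /forallNP xy_eq; apply: xy.
    by apply: functional_extensionality_dep => t; apply: contrapT; exact: xy_eq.
  (* The single coordinate [t] already bounds every adherent level [l] by 0. *)
  apply/le_anti; rewrite i01_ge0 andbT; apply: i01_sup_le => l [_].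
  move=> /prod_adherent_point/(_ t).
  by have /CFT1P -> := cT1 t.
Qed.
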